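(* Let $\kappa$ be an infinite cardinal, $\phi$ a positive modulus, and $X$ a $(<\kappa)$-$\phi$-octahedral real normed space. Then, for every real normed space $Y$ such that $\mathrm{dens}(Y)<\mathrm{cf}(\kappa)$ and every $p\in[1,\infty]$, we have $$\gamma(X\oplus_p Y)\ge\frac{2}{K(X;\kappa)}.$$
   Context: A function $\phi:[0,\infty)\to[0,\infty)$ is a modulus if $\phi(0)=0$, $\phi$ is continuous at $0$, and $t\mapsto\phi(t)/t$ is non-decreasing on $(0,\infty)$; it is a positive modulus if moreover $\phi(t)>0$ for $t>0$. $\mathrm{dens}(Z)$ is the smallest cardinality of a subset of $Z$ whose linear span is dense in $Z$ (so $\mathrm{dens}(Z)<\omega$ means $Z$ is finite-dimensional); $B_Z$, $S_Z$ are the closed unit ball and unit sphere of $Z$. $X$ is $(<\kappa)$-$\phi$-octahedral if for every $\varepsilon>0$ and every subspace $Z$ of $X$ with $\mathrm{dens}(Z)<\kappa$ there is $x\in S_X$ such that $\|z+\lambda x\|\ge(1-\varepsilon)(1+\phi(|\lambda|))$ for all $z\in S_Z$ and $\lambda\in\mathbb{R}$. $\mathrm{cf}(\kappa)$ is the cofinality of $\kappa$. $X\oplus_p Y$ is $X\times Y$ with norm $(\|x\|^p+\|y\|^p)^{1/p}$ (maximum if $p=\infty$). A set $P$ is $r$-separated if $\|x-y\|\ge r$ for all distinct $x,y\in P$, and $r$-dense in $X$ if for every $x\in X$ there is $p\in P$ with $\|x-p\|\le r$. $\gamma(X)=\inf\{r>0:\text{there exists an }r\text{-dense and }2\text{-separated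 set }P\subseteq X\}$. $K(X;\kappa)=\sup\{r>0:B_X\text{ contains an }r\text{-separated set of cardinality }\kappa\}$. *)

(* Defs.v *)
From HB Require Import structures.
From mathcomp Require Import all_boot all_order all_algebra.
From mathcomp Require Import all_classical all_reals all_analysis.
From mathcomp Require wochoice.
Set Implicit Arguments.
Unset Strict Implicit.
Unset Printing Implicit Defensive.
Import Order.TTheory GRing.Theory Num.Theory.
Import numFieldNormedType.Exports.
Local Open Scope classical_set_scope.
Local Open Scope card_scope.
Local Open Scope ring_scope.

Definition card_lt T U (A : set T) (B : set U) := A #<= B /\ ~ (B #<= A).

(* Cardinals of sets are well-ordered: every nonempty family of sets has a
   member of smallest cardinality. A maximal set S of choice functions with
   pairwise distinct values at every D in P must exhaust some D in P. *)
Lemma min_card_exists T (P : set (set T)) : P !=set0 ->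
  exists2 D, P D & forall D', P D' -> D #<= D'.
Proof.
move=> [D0 PD0].
pose good (S : set (set T -> T)) :=
  (forall f D, S f -> P D -> D (f D)) /\
  (forall f g D, S f -> S g -> P D -> f D = g D -> f = g).
have [F Fgood totF|S [[Smem Sinj] Smax]] := @Zorn_bigcup _ [set S | good S].
  split=> [f D [A FA Af] PD|f g D [A FA Af] [B FB Bg] PD].
    by have [h _] := Fgood _ FA; exact: (h f D Af PD).
  have [AB|BA] := totF _ _ FA FB.
    have [_ h] := Fgood _ FB; exact: (h f g D (AB _ Af) Bg PD).
  have [_ h] := Fgood _ FA; exact: (h f g D Af (BA _ Bg) PD).
have [[D PD DS]|noD] :=
    pselect (exists2 D, P D & D `<=` (fun f : set T -> T => f D) @` S).
  exists D => // D' PD'.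
  apply: (card_le_trans (subset_card_le DS)).
  apply: (card_le_trans (card_image_le _ _)).
  have inj : {in S &, injective (fun f : set T -> T => f D')}.
    move=> f g /set_mem Sf /set_mem Sg /= e; exact: (Sinj f g D' Sf Sg PD' e).
  have := inj_card_eq inj; rewrite card_eq_sym => /card_eqPle[h _].
  apply: (card_le_trans h); apply: subset_card_le => _ [f Sf <-].
  exact: (Smem f D' Sf PD').
have out D : P D -> exists2 x, D x & forall f, S f -> f D <> x.
  move=> PD; apply: contra_notP noD => nx; exists D => // x Dx.
  apply: contra_notP nx => nfx; exists x => // f Sf fx.
  by apply: nfx; exists f.
have [x0 _ _] := out _ PD0.
have /choice[f fP] : forall D, exists x, P D -> D x /\ forall g, S g -> g D <> x.
  move=> D; have [PD|nPD] := pselect (P D); last by exists x0.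
  by have [x Dx xS] := out _ PD; exists x.
have nSf : ~ S f by move=> Sf; have [_ /(_ _ Sf)] := fP _ PD0.
exfalso; apply: (Smax (S `|` [set f])).
  split; first exact: subsetUl.
  by move=> /(_ f) fS; apply/nSf/fS; right.
split=> [g D [Sg|->] PD|g h D [Sg|->] [Sh|->] PD // gh].
- exact: (Smem g D Sg PD).
- by have [] := fP _ PD.
- exact: (Sinj g h D Sg Sh PD gh).
- by have [_ /(_ _ Sg)] := fP _ PD.
- by have [_ /(_ _ Sh)] := fP _ PD; rewrite gh.
Qed.

(* A cardinal defined as the smallest cardinality of the members of P is
   represented by a member of P having that cardinality. *)
Definition min_card T (P : set (set T)) : set T :=
  xget set0 [set D | P D /\ forall D', P D' -> D #<= D'].

Lemma min_cardP T (P : set (set T)) : P !=set0 ->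
  P (min_card P) /\ forall D, P D -> min_card P #<= D.
Proof.
move=> /min_card_exists[D PD Dmin]; rewrite /min_card.
by case: xgetP => [_ _ //|/(_ D)[]].
Qed.

(* Cardinals are initial ordinals: well-ordered sets all of whose proper
   initial segments have strictly smaller cardinality. *)
Definition infinite_cardinal d (K : orderType d) :=
  [/\ wochoice.well_order (<=%O : rel K),
      forall k : K, card_lt [set x : K | (x < k)%O] [set: K]
    & infinite_set [set: K]].

Definition cofinal d (K : orderType d) (C : set K) :=
  forall k : K, exists2 c, C c & (k <= c)%O.

Definition cf d (K : orderType d) : set K := min_card (@cofinal d K).
Arguments cf {d} K.

Lemma cofinalT d (K : orderType d) : cofinal [set: K].
Proof. by move=> k; exists k. Qed.

Definition is_subspace (R : realType) (X : normedModType R) (Z : set X) :=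
  submod_closed [in Z].

Definition lspan (R : realType) (X : normedModType R) (D : set X) : set X :=
  smallest (@is_subspace R X) D.

Definition dens (R : realType) (X : normedModType R) (Z : set X) : set X :=
  min_card [set D | D `<=` Z /\ Z `<=` closure (lspan D)].

Lemma dens_set_nonempty (R : realType) (X : normedModType R) (Z : set X) :
  [set D | D `<=` Z /\ Z `<=` closure (lspan D)] !=set0.
Proof.
by exists Z; split=> // x Zx; apply: subset_closure; exact: sub_gen_smallest.
Qed.

(* Functions on [0, +oo[ are represented by functions on R whose values at
   negative arguments are irrelevant. *)
Definition modulus (R : realType) (phi : R -> R) :=
  [/\ forall t, 0 <= t -> 0 <= phi t,
      phi 0 = 0,
      phi t @[t --> 0^'+] --> phi 0
    & forall s t, 0 < s -> s <= t -> phi s / s <= phi t / t].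

Definition positive_modulus (R : realType) (phi : R -> R) :=
  modulus phi /\ forall t, 0 < t -> 0 < phi t.

Definition octahedral d (K : orderType d) (R : realType) (phi : R -> R)
    (X : normedModType R) :=
  forall (e : R) (Z : set X), 0 < e -> is_subspace Z ->
    card_lt (dens Z) [set: K] ->
  exists2 x : X, `|x| = 1 &
    forall (z : X) (l : R), Z z -> `|z| = 1 ->
      (1 - e) * (1 + phi `|l|) <= `|z + l *: x|.

(* The norm of the p-sum, for 1 <= p <= +oo; the norm that the library puts
   on X * Y is the case p = +oo. *)
Definition psum_norm (R : realType) (X Y : normedModType R) (p : \bar R)
    (z : X * Y) : R :=
  if p is q%:E then (`|z.1| `^ q + `|z.2| `^ q) `^ q^-1
  else Num.max `|z.1| `|z.2|.

(* The next three notions depend on the norm N, so as to apply to the p-sums. *)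
Definition rseparated (R : realType) (V : zmodType) (N : V -> R) (r : R)
    (P : set V) :=
  forall x y, P x -> P y -> x <> y -> r <= N (x - y).

Definition rdense (R : realType) (V : zmodType) (N : V -> R) (r : R)
    (P : set V) :=
  forall x, exists2 y, P y & N (x - y) <= r.

(* For a norm N, a maximal 2-separated set is 2-dense, hence the infimum is
   that of a nonempty set. *)
Definition gamma (R : realType) (V : zmodType) (N : V -> R) : R :=
  inf [set r | 0 < r /\ exists2 P : set V, rdense N r P & rseparated N 2 P].

(* When K has at least two elements the set is bounded by 2. *)
Definition kottman (R : realType) (X : normedModType R) (K : Type) : R :=
  sup [set r | 0 < r /\ exists P : set X,
    [/\ P `<=` [set x | `|x| <= 1], rseparated Num.norm r P & P #= [set: K]]].

(* Main.v *)
Require Import Defs.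
From HB Require Import structures.
From mathcomp Require Import all_boot all_order all_algebra.
From mathcomp Require Import all_classical all_reals all_analysis.
From mathcomp Require Import ring lra.
Set Implicit Arguments.
Unset Strict Implicit.
Unset Printing Implicit Defensive.
Import Order.TTheory GRing.Theory Num.Theory.
Import numFieldNormedType.Exports.
Local Open Scope classical_set_scope.
Local Open Scope ring_scope.
Local Open Scope card_scope.

(** Let [P] be [r]-dense and 2-separated in the [p]-sum of [X] and [Y], let [l >
0] be small, and consider the cylinders of points whose [X]-component is
within [r + l], and whose [Y]-component is within [r], of those of a centre.

Some cylinder contains at least [K] points of [P]
([octahedral_crowded_cylinder]). Otherwise the octahedral directions of [X]
would allow moving the centre by [l] so that all the points of [P] near it
get farther away in [X] by a fixed amount. Measured from the old centre, the
points of [P] that are close to the new one are then closer in [X] by that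
amount. Repeating this produces points at negative distance. The [p]-norm
enters through its monotonicity in the norms of the two components, which is
why all exponents can be treated at once.

Among these [K] points, [K] have [Y]-components within [l] of one another
([dens_concentration]). Indeed the [Y]-components are bounded, and up to a
small error each lies in the span of finitely many elements of a set of fewer
than [cf K] vectors; the pigeonhole principle for fewer than [cf K] classes
([cf_pigeonhole]) fixes these finitely many elements, and then the
coefficients up to a small error. The [X]-components of the points that
remain are [(2 - l)]-separated in a ball of radius [r + l], so that [(2 - l)
/ (r + l) <= kottman X K]; let [l] tend to 0.

The pigeonhole principle holds for singular [K] too, and rests on
Hessenberg's theorem for the initial segments of [K] ([segment_squared]). *)

(** * Cardinals below an initial ordinal *)

Lemma inj_card_le_set T U (A : set T) (B : set U) (f : T -> U) :
  (forall x, A x -> B (f x)) ->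
  (forall x y, A x -> A y -> f x = f y -> x = y) -> A #<= B.
Proof.
move=> fAB finj.
have fi : {in A &, injective f} by move=> x y /set_mem Ax /set_mem Ay /finj; apply.
have := inj_card_eq fi; rewrite card_eq_sym => /card_eqPle[+ _].
move=> /card_le_trans; apply; apply: subset_card_le => _ [x Ax <-]; exact: fAB.
Qed.

Lemma card_le_set_inj T U (A : set T) (B : set U) (b : U) : A #<= B ->
  exists f : T -> U, (forall x, A x -> B (f x)) /\
    forall x y, A x -> A y -> f x = f y -> x = y.
Proof.
move=> /card_leP[f].
have [g gfun ginj] : exists2 g : T -> U, set_fun A B g & set_inj A g.
  by apply/injfunPex; squash (valLR b f).
exists g; split=> [x Ax|x y Ax Ay]; first exact: gfun.
by apply: ginj; apply/mem_set.
Qed.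

Lemma card_leX T T' U U' (A : set T) (A' : set T') (B : set U) (B' : set U')
    (b : U) (b' : U') :
  A #<= B -> A' #<= B' -> A `*` A' #<= B `*` B'.
Proof.
move=> /(card_le_set_inj b)[f [fB finj]] /(card_le_set_inj b')[g [gB ginj]].
apply: (@inj_card_le_set _ _ _ _ (fun x => (f x.1, g x.2))).
  by move=> [x y] [/= /fB ? /gB ?].
by move=> [x y] [x' y'] [/= ? ?] [/= ? ?] [/finj-> // /ginj->].
Qed.

(** A second copy of [A] has room for the extra point: [A * A] contains [A * {a}]
and a further point [(a, b)]. *)
Lemma infinite_card_leU1 T (A : set T) (p : T) :
  infinite_set A -> A `*` A #<= A -> p |` A #<= A.
Proof.
move=> Ainf AA.
have [a Aa] : A !=set0 by apply/set0P/eqP => A0; apply: Ainf; rewrite A0.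
have [b Ab ab] : exists2 b, A b & a <> b.
  apply: contrapT => nb; apply: Ainf; apply: (sub_finite_set _ (finite_set1 a)).
  by move=> b Ab /=; apply: contrapT => ba; apply: nb; exists b => // /esym.
apply: card_le_trans AA.
have [Ap|nAp] := pselect (A p).
  apply: (@inj_card_le_set _ _ _ _ (fun x => (x, a))) => [x [->|Ax]//|x y _ _ []//].
apply: (@inj_card_le_set _ _ _ _
    (fun x => if x == p :> {classic T} then (a, b) else (x, a))).
  by move=> x [->|Ax] /=; [rewrite eqxx | case: ifP].
move=> x y _ _; case: eqP => xp; case: eqP => yp; first by rewrite xp yp.
- by case=> _ /esym.
- by case.
- by case.
Qed.

Section Greedy.
Variables (W T : Type) (lt : W -> W -> Prop).
Hypothesis lt_min : forall Q : set W, Q !=set0 ->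
  exists2 w, Q w & forall w', Q w' -> ~ lt w' w.

Lemma min_well_founded : well_founded lt.
Proof.
move=> w; apply: contrapT => nw.
have [m nm mmin] := lt_min (ex_intro [set w | ~ Acc lt w] w nw).
by apply: nm; constructor => y ym; apply: contrapT => ny; exact: (mmin _ ny ym).
Qed.

Hypothesis lt_total : forall w w', [\/ lt w w', w = w' | lt w' w].

(** Transfinite recursion sends each [w] in [A] to a point of [B] not used by its
predecessors in [A]; the recursion can only get stuck when the images of
these predecessors exhaust [B]. *)
Lemma card_le_greedy (A : set W) (B : set T) :
  (forall w, A w -> ~ (B #<= [set w' | A w' /\ lt w' w])) -> A #<= B.
Proof.
move=> AB.
have [->|/set0P[w0 Aw0]] := eqVneq A set0; first exact: card_ge0.
have [b _] : B !=set0.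
  by apply/set0P/eqP => B0; apply: (AB _ Aw0); rewrite B0; exact: card_ge0.
have /choice[pick pickP] : forall Q : set T, exists c, Q !=set0 -> Q c.
  by move=> Q; have [[c Qc]|] := pselect (Q !=set0); [exists c | exists b].
pose free w (rec : forall w', lt w' w -> T) :=
  [set c | B c /\ forall w' (h : lt w' w), A w' -> rec w' h <> c].
pose f := Fix min_well_founded (fun=> T) (fun w rec => pick (free w rec)).
have fE w : f w = pick [set c | B c /\ forall w', lt w' w -> A w' -> f w' <> c].
  rewrite /f Fix_eq // => x g h gh; congr pick.
  by apply/seteqP; split=> c [Bc cP]; split=> // w' h'; [rewrite -gh|rewrite gh];
    exact: cP.
have fP w : A w -> B (f w) /\ forall w', lt w' w -> A w' -> f w' <> f w.
  move=> Aw; have [c cP] : [set c | B c /\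
      forall w', lt w' w -> A w' -> f w' <> c] !=set0.
    apply: contrapT => /set0P/negP; rewrite negbK => /eqP free0.
    apply: (AB _ Aw); apply: card_le_trans (card_image_le f _).
    apply: subset_card_le => c Bc; apply: contrapT => cnf.
    suff : set0 c by [].
    rewrite -free0; split=> // w' ww' Aw' fw'; apply: cnf.
    by exists w'.
  by have := pickP _ (ex_intro _ c cP); rewrite -fE.
apply: (@inj_card_le_set _ _ _ _ f) => [w /fP[]//|w w' Aw Aw' ff].
have [ww'|//|w'w] := lt_total w w'.
- by have [_ /(_ _ ww' Aw)] := fP _ Aw'.
- by have [_ /(_ _ w'w Aw')] := fP _ Aw; rewrite ff.
Qed.
End Greedy.

Section InitialOrdinal.
Context {d : Order.disp_t} {K : orderType d}.
Hypothesis Kcard : infinite_cardinal K.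

Definition segment (k : K) : set K := [set x | (x < k)%O].

Lemma well_order_min (Q : set K) : Q !=set0 ->
  exists2 k, Q k & forall k', Q k' -> (k <= k')%O.
Proof.
case: Kcard => Kwo _ _ [q Qq].
have [k [[/set_mem Qk kmin] _]] := Kwo [in Q] (ex_intro _ q (mem_set Qq)).
by exists k => // k' Qk'; apply: kmin; exact: mem_set.
Qed.

Lemma segment_card_lt k : ~ ([set: K] #<= segment k).
Proof. by case: Kcard => _ /(_ k)[]. Qed.

(** Comparability of cardinals, in the sharp form that an initial ordinal
provides: were [A] larger than every proper initial segment, the greedy
recursion would embed all of [K] into it. *)
Lemma card_le_segment T (A : set T) : ~ ([set: K] #<= A) ->
  exists k, A #<= segment k.
Proof.
apply: contra_notP => /forallNP Ak.
apply: (@card_le_greedy _ _ (fun x y : K => (x < y)%O)) => [Q Q0|x y|k _].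
- have [k Qk kmin] := well_order_min Q0; exists k => // k' /kmin.
  by rewrite leNgt => /negP.
- by have [xy|xy|->] := ltgtP x y; [constructor 1|constructor 3|constructor 2].
- move=> Ak'; apply: (Ak k); apply: card_le_trans Ak' _.
  by apply: subset_card_le => x [].
Qed.

Lemma card_lt_cardinalP T (A : set T) :
  card_lt A [set: K] <-> ~ ([set: K] #<= A).
Proof.
split=> [[]//|KA]; split=> //.
have [k Ak] := card_le_segment KA; apply: card_le_trans Ak _; exact: card_leT.
Qed.

(** Hessenberg's theorem, by induction on [k]. For the Goedel order on pairs
(compare maxima, then first, then second components) the predecessors of [(a,
b)] lie in the square of the segment up to [m = max a b], which by induction
is no larger than [segment m] when that is infinite. If [segment k] had no
room for its square, the greedy recursion would stop at some such pair, so
that [segment k] would be no larger than [segment m]; its square would then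
fit after all. *)
Lemma segment_squared k : infinite_set (segment k) ->
  segment k `*` segment k #<= segment k.
Proof.
move=> kinf; apply: contrapT => kk.
have [{kinf kk}k [kinf kk] kmin] := well_order_min (ex_intro
  [set k | infinite_set (segment k) /\ ~ (segment k `*` segment k #<= segment k)]
  k (conj kinf kk)).
pose le m : set K := m |` segment m.
pose goedel (x y : K * K) := let m (x : K * K) := Order.max x.1 x.2 in
  (m x < m y)%O \/ (m x = m y /\ ((x.1 < y.1)%O \/ (x.1 = y.1 /\ (x.2 < y.2)%O))).
apply: (kk).
apply: (@card_le_greedy _ _ goedel) => [Q Q0|[x x'] [y y']|[a b] [/= ak bk]].
- have [[x0 y0] Qxy0] := Q0.
  have [m [[x1 y1] /= Qxy1 mE] mmin] := well_order_min
    (ex_intro [set m | exists2 z : K * K, Q z & m = Order.max z.1 z.2]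
      _ (ex_intro2 _ _ _ Qxy0 erefl)).
  have [x [y2 [Qxy2 mE2]] xmin] := well_order_min
    (ex_intro [set x | exists y : K, Q (x, y) /\ m = Order.max x y]
      _ (ex_intro _ _ (conj Qxy1 mE))).
  have [y [Qxy mE3] ymin] := well_order_min
    (ex_intro [set y | Q (x, y) /\ m = Order.max x y] _ (conj Qxy2 mE2)).
  exists (x, y) => // -[x' y'] Q' [/=|[/= mE' [|[x'E]]]]; rewrite -?mE3 => l.
  + by have := mmin _ (ex_intro2 _ _ _ Q' erefl); rewrite leNgt l.
  + have : (x <= x')%O by apply: xmin; exists y'; rewrite mE' -mE3.
    by rewrite leNgt l.
  + have : (y <= y')%O by apply: ymin; rewrite -x'E mE' -mE3.
    by rewrite leNgt l.
- rewrite /goedel /=.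
  have [l|l|->] := ltgtP (Order.max x x') (Order.max y y').
  + by constructor 1; left.
  + by constructor 3; left.
  have [l|l|->] := ltgtP x y.
  + by constructor 1; right; split=> //; left.
  + by constructor 3; right; split=> //; left.
  have [l|l|->] := ltgtP x' y'.
  + by constructor 1; right; split=> //; right.
  + by constructor 3; right; split=> //; right.
  + by constructor 2.
(* The greedy recursion is stuck at (a, b). *)
move=> kab; pose m := Order.max a b.
have mk : (m < k)%O by rewrite /m gt_max ak.
have {kab}kle : segment k #<= le m `*` le m.
  apply: card_le_trans kab _; apply: subset_card_le => -[x y] /= [_ xy].
  suff : (Order.max x y <= m)%O.
    by rewrite ge_max !le_eqVlt => /andP[/predU1P[->|xm] /predU1P[->|ym]];
      split; rewrite /le /=; (by left) || (by right).
  by rewrite /m; case: xy => [/ltW//|[->]].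
have [minf|mfin] := pselect (infinite_set (segment m)); last first.
  apply: kinf; apply: card_le_finite kle _; apply: finite_setX;
  by rewrite /le finite_setU; split; [exact: finite_set1 | exact: contrapT].
have mm : segment m `*` segment m #<= segment m.
  by apply: contrapT => mm; have := kmin m (conj minf mm); rewrite leNgt mk.
have lem : le m #<= segment m by exact: infinite_card_leU1.
have km : segment k #<= segment m.
  apply: card_le_trans kle _; apply: card_le_trans mm.
  by apply: card_leX.
apply: kk; apply: card_le_trans (card_leX k k km km) _; apply: card_le_trans mm _.
by apply: subset_card_le => x /= xm; exact: lt_trans xm mk.
Qed.

(** Removing the largest element of an infinite set would not change its
cardinality, against the minimality of [K]. *)
Lemma cardinal_no_max (k : K) : exists k', (k < k')%O.
Proof.
apply: contrapT => /forallNP kmax; apply: (@segment_card_lt k).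
have kT : [set: K] = k |` segment k.
  apply/seteqP; split=> // x _ /=.
  by have [xk|kx|->] := ltgtP x k; [right|have := kmax _ kx|left].
rewrite [X in X #<= _]kT.
have kinf : infinite_set (segment k).
  case: Kcard => _ _ Kinf kfin; apply: Kinf; rewrite kT.
  by rewrite finite_setU; split=> //; exact: finite_set1.
by apply: infinite_card_leU1 => //; exact: segment_squared.
Qed.

Lemma cf_card_le (C : set K) : cofinal C -> cf K #<= C.
Proof.
by have [_] := min_cardP (ex_intro (@cofinal d K) _ (@cofinalT d K)); apply.
Qed.

(** The cofinality is infinite, because finite subsets of [K] are strictly
bounded. *)
Lemma finite_card_lt_cf T (J : set T) : finite_set J -> card_lt J (cf K).
Proof.
have [cfK _] := min_cardP (ex_intro (@cofinal d K) _ (@cofinalT d K)).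
have cfinf : infinite_set (cf K).
  case/(finite_seqP (T:=K)) => s sE.
  have [k kP] : exists k, forall c, c \in s -> (c < k)%O.
    elim: s {sE} => [|c s [k kP]].
      by case: Kcard => _ _ Kinf; have [k _] := infinite_setN0 Kinf; exists k.
    have [c' cc'] := cardinal_no_max c.
    exists (Order.max c' k) => x; rewrite inE lt_max => /predU1P[->|/kP->].
      by rewrite cc'.
    by rewrite orbT.
  have [c + kc] := cfK k; rewrite -/(cf K) sE /= => /kP.
  by rewrite ltNge kc.
move=> Jfin; split; last by move=> /card_le_finite/(_ Jfin).
have [n Jn] := Jfin.
move: cfinf => /infiniteP; apply: card_le_trans.
by move: Jn => /card_eqPle[/card_le_trans + _]; apply; exact: card_leT.
Qed.

(** Fewer than [cf K] classes, each of size less than [K], have sizes bounded by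
one [segment m], since the bounds are not cofinal, and [m] can be taken large
enough to bound the number of classes too. The whole set then embeds in
[segment m * segment m], which is smaller than [K] by Hessenberg's theorem.
*)
Lemma cf_pigeonhole T U (S : set T) (h : T -> U) (J : set U) :
  [set: K] #<= S -> (forall x, S x -> J (h x)) -> card_lt J (cf K) ->
  exists u, [set: K] #<= [set x | S x /\ h x = u].
Proof.
move=> KS hJ [_ Jcf]; apply: contrapT => /forallNP Su.
have /choice[k kP] : forall u, exists k, [set x | S x /\ h x = u] #<= segment k.
  by move=> u; exact: card_le_segment.
have [m1 m1P] : exists m, forall u, J u -> (k u < m)%O.
  apply: contrapT => nm; apply: Jcf.
  apply: card_le_trans (card_image_le k J); apply: cf_card_le => m.
  apply: contrapT => mC; apply: nm; exists m => u Ju; rewrite ltNge.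
  by apply/negP => mk; apply: mC; exists (k u) => //; exists u.
have [m2 Jm2] : exists m, J #<= segment m.
  apply: card_le_segment => KJ; apply: Jcf; apply: card_le_trans KJ.
  by apply: cf_card_le; exact: cofinalT.
pose m := Order.max m1 m2.
have Sm u : J u -> [set x | S x /\ h x = u] #<= segment m.
  move=> /m1P ku; apply: card_le_trans (kP u) _; apply: subset_card_le => x /= xk.
  by rewrite /segment /= lt_max (lt_trans xk ku).
have Jm : J #<= segment m.
  apply: card_le_trans Jm2 _; apply: subset_card_le => x /= xk.
  by rewrite /segment /= lt_max xk orbT.
have [j [jm jinj]] := card_le_set_inj m Jm.
have /choice[g gP] : forall u, exists g : T -> K, J u ->
    (forall x, S x /\ h x = u -> segment m (g x)) /\
    forall x y, S x /\ h x = u -> S y /\ h y = u -> g x = g y -> x = y.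
  move=> u; have [Ju|] := pselect (J u); last by exists (fun=> m).
  by have [g gP] := card_le_set_inj m (Sm u Ju); exists g.
have Smm : S #<= segment m `*` segment m.
  apply: (@inj_card_le_set _ _ _ _ (fun x => (j (h x), g (h x) x))).
    by move=> x Sx; split=> /=; [exact/jm/hJ | apply: (gP _ (hJ _ Sx)).1].
  move=> x y Sx Sy [/jinj hxy]; have {}hxy := hxy (hJ _ Sx) (hJ _ Sy).
  by rewrite hxy; apply: (gP _ (hJ _ Sy)).2.
have [minf|mfin] := pselect (infinite_set (segment m)).
  apply: (@segment_card_lt m); apply: card_le_trans KS _.
  by apply: card_le_trans Smm _; exact: segment_squared.
case: Kcard => _ _; apply; apply: card_le_finite (card_le_trans KS Smm) _.
by apply: finite_setX; exact: contrapT.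
Qed.
End InitialOrdinal.

(** * Linear spans and octahedral directions *)

Section Span.
Context {R : realType} {X : normedModType R}.
Implicit Types (Z D : set X) (s : seq X).

Lemma is_subspaceP Z : is_subspace Z <->
  Z 0 /\ forall (a : R) u v, Z u -> Z v -> Z (a *: u + v).
Proof.
split=> [[/set_mem Z0 ZD]|[Z0 ZD]]; split=> //.
- by move=> a u v /mem_set Zu /mem_set Zv; apply/set_mem; exact: ZD.
- exact: mem_set.
- by move=> a u v /set_mem Zu /set_mem Zv; apply/mem_set; exact: ZD.
Qed.

Lemma lspan_is_subspace D : is_subspace (lspan D).
Proof.
apply/is_subspaceP; split=> [Z [/is_subspaceP[Z0 _] _]//|a u v Du Dv Z ZP].
by case: (ZP) => /is_subspaceP[_ ZD] _; apply: ZD; [exact: Du | exact: Dv].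
Qed.

Lemma sub_lspan D : D `<=` lspan D.
Proof. exact: sub_gen_smallest. Qed.

Lemma lspan_sub D Z : is_subspace Z -> D `<=` Z -> lspan D `<=` Z.
Proof. by move=> ZP DZ; apply: smallest_sub. Qed.

Lemma lspan_cons v s y : lspan [set` v :: s] y ->
  exists (a : R) (f : X), lspan [set` s] f /\ y = a *: v + f.
Proof.
have [s0 sD] := (is_subspaceP _).1 (lspan_is_subspace [set` s]).
move: y; apply: lspan_sub => [|x /=]; last first.
  rewrite inE => /predU1P[->|xs]; first by exists 1, 0; rewrite scale1r addr0.
  by exists 0, x; rewrite scale0r add0r; split=> //; exact: sub_lspan.
apply/is_subspaceP; split; first by exists 0, 0; rewrite scale0r addr0.
move=> c _ _ [a [f [sf ->]]] [b [g [sg ->]]].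
exists (c * a + b), (c *: f + g); split; first exact: sD.
by rewrite scalerDl scalerDr scalerA addrACA.
Qed.

Lemma lspan_nil (y : X) : lspan [set` [::]] y -> y = 0.
Proof.
move: y; apply: lspan_sub => //; apply/is_subspaceP; split=> // a u v -> ->.
by rewrite scaler0 addr0.
Qed.

Lemma lspan_finite_support D y : lspan D y ->
  exists s, (forall x, x \in s -> D x) /\ lspan [set` s] y.
Proof.
move: y; apply: lspan_sub => [|x Dx]; last first.
  exists [:: x]; split=> [z|]; first by rewrite inE => /eqP->.
  by apply: sub_lspan; rewrite /= inE.
apply/is_subspaceP; split.
  by exists [::]; split=> //; case/is_subspaceP: (lspan_is_subspace [set` [::]]).
move=> a u v [s [sD su]] [t [tD tv]]; exists (s ++ t); split.
  by move=> x; rewrite mem_cat => /orP[/sD|/tD].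
have [_ + ] := (is_subspaceP _).1 (lspan_is_subspace [set` s ++ t]); apply.
  apply: lspan_sub su; first exact: lspan_is_subspace.
  by move=> x /= xs; apply: sub_lspan; rewrite /= mem_cat xs.
apply: lspan_sub tv; first exact: lspan_is_subspace.
by move=> x /= xs; apply: sub_lspan; rewrite /= mem_cat xs orbT.
Qed.

Lemma dens_lspan_le D : dens (lspan D) #<= D.
Proof.
have [_] := min_cardP (dens_set_nonempty (lspan D)); apply.
by split; [exact: sub_lspan | exact: subset_closure].
Qed.

End Span.

(** For [t = `|z|] in [(0, T]], homogeneity turns the octahedral inequality into
the lower bound [(1 - e) * (t + t * phi (l / t))]; monotonicity of [phi s /
s] makes the gain [t * phi (l / t)] at least its value [q] at [t = T], and
the factor [1 - e] is chosen so as to lose at most half of it. At [z = 0] the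
gain is [l]. *)
Lemma octahedral_gap (R : realType) (d : Order.disp_t) (K : orderType d)
    (phi : R -> R) (X : normedModType R) (T l : R) :
  positive_modulus phi -> octahedral K phi X -> 0 < T -> 0 < l ->
  exists2 c : R, 0 < c & forall Z : set X, is_subspace Z ->
    card_lt (dens Z) [set: K] ->
    exists x : X, `|x| = 1 /\
      forall z, Z z -> `|z| <= T -> `|z| + c <= `|z - l *: x|.
Proof.
move=> [[_ _ _ phimono] phipos] oct T0 l0.
pose q := T * phi (l / T).
have q0 : 0 < q by rewrite mulr_gt0// phipos// divr_gt0.
pose e := q / (2 * (T + q)).
have Tq : 0 < T + q by rewrite addr_gt0.
have e0 : 0 < e by rewrite divr_gt0// mulr_gt0.
have eE : e * (T + q) = q / 2 by rewrite /e; field; lra.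
have e1 : e < 1.
  by rewrite /e ltr_pdivrMr ?mul1r ?mulr_gt0//; lra.
exists (Num.min l (q / 2)); first by rewrite lt_min l0 divr_gt0.
move=> Z Zsub Zdens; have [x x1 xP] := oct e Z e0 Zsub Zdens.
exists x; split=> // z Zz zT.
have [->|zN0] := eqVneq z 0.
  by rewrite normr0 !add0r normrN normrZ x1 mulr1 gtr0_norm// ge_min lexx.
have t0 : 0 < `|z| by rewrite normr_gt0.
set t := `|z| in zT t0 *.
have [Z0 ZD] := (is_subspaceP _).1 Zsub.
have := xP (t^-1 *: z) (- (l / t)).
rewrite normrZ normfV normr_id mulVf ?gt_eqF// => /(_ _ erefl).
rewrite normrN gtr0_norm ?divr_gt0// => h.
have {}h : (1 - e) * (1 + phi (l / t)) <= `|t^-1 *: z + - (l / t) *: x|.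
  by apply: h; rewrite -[_ *: z]addr0; exact: ZD.
have zE : z - l *: x = t *: (t^-1 *: z + - (l / t) *: x).
  rewrite scalerDr !scalerA mulfV ?gt_eqF// scale1r mulrN mulrC divfK ?gt_eqF//.
  by rewrite scaleNr.
rewrite zE normrZ (gtr0_norm t0).
have qt : q <= t * phi (l / t).
  have := phimono (l / T) (l / t); rewrite divr_gt0// ler_pM2l// lef_pV2 ?posrE//.
  move=> /(_ isT zT); rewrite -(ler_pM2l l0).
  have aE u b : 0 < u -> l * (b / (l / u)) = u * b by move=> u0; field; lra.
  by rewrite !aE.
have : t * ((1 - e) * (1 + phi (l / t))) <=
  t * `|t^-1 *: z + - (l / t) *: x| by rewrite ler_pM2l.
apply: le_trans.
apply: (@le_trans _ _ (t + q / 2)); first by rewrite lerD2l ge_min lexx orbT.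
have -> : t * ((1 - e) * (1 + phi (l / t))) = (1 - e) * (t + t * phi (l / t)) by ring.
apply: (@le_trans _ _ ((1 - e) * (t + q))); last first.
  by rewrite ler_pM2l ?subr_gt0// lerD2l.
have : e * (t + q) <= e * (T + q) by rewrite ler_pM2l// lerD2r.
rewrite eE; lra.
Qed.

(** * Norms of p-sums and packing-covering sets *)

Section PsumNorm.
Context {R : realType} {X Y : normedModType R} {p : \bar R}.
Hypothesis p1 : (1%:E <= p)%E.
Local Notation N := (@psum_norm R X Y p).

Lemma le_psum_norm (a b : X * Y) :
  `|a.1| <= `|b.1| -> `|a.2| <= `|b.2| -> N a <= N b.
Proof.
move=> ab1 ab2; rewrite /psum_norm; move: p1; case: p => [q| |//].
  rewrite lee_fin => q1; have q0 : 0 <= q by rewrite (le_trans _ q1).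
  apply: ge0_ler_powR; rewrite ?invr_ge0 ?nnegrE ?addr_ge0 ?powR_ge0//.
  by apply: lerD; apply: ge0_ler_powR; rewrite ?nnegrE.
by move=> _; rewrite ge_max !le_max ab1 ab2 orbT.
Qed.

Lemma psum_normN (a : X * Y) : N (- a) = N a.
Proof. by apply/le_anti/andP; split; apply: le_psum_norm; rewrite /= normrN. Qed.

Lemma psum_norm0 : N 0 = 0.
Proof.
rewrite /psum_norm; move: p1; case: p => [q| |//].
  rewrite lee_fin => q1; have q0 : q != 0 by rewrite gt_eqF// (lt_le_trans _ q1).
  by rewrite /= !normr0 powR0// addr0 powR0// invr_neq0.
by move=> _ /=; rewrite !normr0 maxxx.
Qed.

Lemma psum_norm_embed1 (x : X) : N (x, 0) = `|x|.
Proof.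
rewrite /psum_norm /= normr0; move: p1; case: p => [q| |//].
  rewrite lee_fin => q1; have q0 : q != 0 by rewrite gt_eqF// (lt_le_trans _ q1).
  by rewrite powR0// addr0 -powRrM mulfV// powRr1.
by move=> _; apply/max_idPl.
Qed.

Lemma norm1_le_psum_norm (a : X * Y) : `|a.1| <= N a.
Proof. by rewrite -psum_norm_embed1; apply: le_psum_norm; rewrite /= ?normr0. Qed.

Lemma norm2_le_psum_norm (a : X * Y) : `|a.2| <= N a.
Proof.
suff <- : N (0, a.2) = `|a.2| by apply: le_psum_norm; rewrite /= ?normr0.
rewrite /psum_norm /= normr0; move: p1; case: p => [q| |//].
  rewrite lee_fin => q1; have q0 : q != 0 by rewrite gt_eqF// (lt_le_trans _ q1).
  by rewrite powR0// add0r -powRrM mulfV// powRr1.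
by move=> _; apply/max_idPr.
Qed.

(** For [0 <= u <= s] one has [u `^ q <= u * s `^ (q - 1)]; adding the two
instances with [s] the sum of the norms gives the inequality between [q]-th
powers. *)
Lemma psum_norm_le_add (a : X * Y) : N a <= `|a.1| + `|a.2|.
Proof.
rewrite /psum_norm; move: p1; case: p => [q| |//]; last first.
  by move=> _; rewrite ge_max lerDl lerDr !normr_ge0.
rewrite lee_fin => q1; set s := `|a.1| + `|a.2|.
have s0 : 0 <= s by rewrite addr_ge0.
have q0 : 0 < q by rewrite (lt_le_trans _ q1).
have -> : s = (s `^ q) `^ q^-1 by rewrite -powRrM mulfV ?gt_eqF// powRr1.
apply: ge0_ler_powR; rewrite ?invr_ge0 ?nnegrE ?addr_ge0 ?powR_ge0 ?(ltW q0)//.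
have [s00|sN0] := eqVneq s 0.
  have /andP[/eqP-> /eqP->] : (`|a.1| == 0) && (`|a.2| == 0).
    by rewrite -paddr_eq0// -/s s00.
  by rewrite powR0 ?gt_eqF// addr0 powR_ge0.
have h (u : R) : 0 <= u -> u <= s -> u `^ q <= u * s `^ (q - 1).
  move=> u0 us; have [->|uN0] := eqVneq u 0; first by rewrite powR0 ?mul0r ?gt_eqF.
  have up : 0 < u by rewrite lt_neqAle eq_sym uN0.
  have -> : u `^ q = u * u `^ (q - 1).
    by rewrite -[in X in X * _](powRr1 u0) -powRD ?uN0 ?implybT// addrC subrK.
  by rewrite ler_pM2l//; apply: ge0_ler_powR; rewrite ?nnegrE ?subr_ge0.
apply: (@le_trans _ _ (`|a.1| * s `^ (q - 1) + `|a.2| * s `^ (q - 1))).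
  by apply: lerD; apply: h; rewrite ?lerDl ?lerDr.
rewrite -mulrDl -/s -[in X in X * _](powRr1 s0) -powRD ?sN0 ?implybT//.
by rewrite addrC subrK.
Qed.

(** A point at distance at least 2 from every point of a maximal 2-separated set
could be added to it. *)
Lemma maximal_separated_dense : exists P : set (X * Y),
  rseparated N 2 P /\ rdense N 2 P.
Proof.
have [F Fgood totF|P [Psep Pmax]] :=
    @Zorn_bigcup _ [set P : set (X * Y) | rseparated N 2 P].
  move=> x y [A FA Ax] [B FB By].
  have [AB|BA] := totF _ _ FA FB; first exact: Fgood _ FB _ _ (AB _ Ax) By.
  exact: Fgood _ FA _ _ Ax (BA _ By).
exists P; split=> // x; apply: contrapT => nx.
have far y : P y -> 2 <= N (x - y).
  by move=> Py; rewrite leNgt; apply/negP => /ltW xy; apply: nx; exists y.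
apply: (Pmax (P `|` [set x])).
  split; first exact: subsetUl.
  move=> /(_ x) Px; apply: nx; exists x; first by apply: Px; right.
  by rewrite subrr psum_norm0.
move=> y z [Py|->] [Pz|->] yz //; first exact: Psep.
  by rewrite -psum_normN opprB; exact: far.
exact: far.
Qed.

(** The infimum of the empty set is 0 by convention, so that a lower bound for
[gamma] needs an admissible set, which [maximal_separated_dense] provides. *)
Lemma gamma_ge (c : R) :
  (forall r P, 0 < r -> rdense N r P -> rseparated N 2 P -> c <= r) ->
  c <= gamma N.
Proof.
move=> cP; apply: lb_le_inf => [|r [r0 [P Pd Ps]]]; last exact: (cP r P).
by have [P [Ps Pd]] := maximal_separated_dense; exists 2; split=> //; exists P.
Qed.

End PsumNorm.

(** * Families of small diameter in a space of small density *)

Section Concentration.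
Context {R : realType} {d : Order.disp_t} {K : orderType d} {Y : normedModType R}.
Hypothesis Kcard : infinite_cardinal K.

Lemma ler_dist_approx (u v u' v' : Y) (e : R) :
  `|u - u'| <= e / 3 -> `|v - v'| <= e / 3 -> `|u' - v'| <= e / 3 ->
  `|u - v| <= e.
Proof.
move=> uu' vv' u'v'.
have -> : u - v = (u - u') + (u' - v') - (v - v').
  by rewrite addrA subrK opprB addrA subrK.
have := ler_normB (u - u' + (u' - v')) (v - v').
have := ler_normD (u - u') (u' - v'); lra.
Qed.

Lemma bounded_scalar_pigeonhole T (S : set T) (a : T -> R) (B t : R) :
  [set: K] #<= S -> (forall x, S x -> `|a x| <= B) -> 0 < t ->
  exists2 S' : set T, S' `<=` S /\ [set: K] #<= S' &
    forall x y, S' x -> S' y -> `|a x - a y| <= t.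
Proof.
move=> KS aB t0.
pose h x := Num.truncn ((a x + B) / t).
have hitv x : S x -> (h x)%:R * t <= a x + B < (h x).+1%:R * t.
  move=> /aB; rewrite ler_norml => /andP[aB1 _].
  rewrite -ler_pdivlMr// -ltr_pdivrMr//; apply: truncn_itv.
  by rewrite divr_ge0 ?(ltW t0)//; lra.
have hJ x : S x -> `I_(Num.truncn ((B + B) / t)).+1 (h x).
  move=> /aB; rewrite ler_norml => /andP[_ aB2] /=.
  by rewrite ltnS; apply: le_truncn; rewrite ler_pM2r ?invr_gt0// lerD2r.
have [m Km] := cf_pigeonhole Kcard KS hJ (finite_card_lt_cf Kcard (finite_II _)).
exists [set x | S x /\ h x = m]; first by split=> // x [].
move=> x y [/hitv/[swap]-> /andP[x1 x2]] [/hitv/[swap]-> /andP[y1 y2]].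
rewrite ler_norml; move: x2 y2; rewrite -natr1 !mulrDl mul1r => x2 y2.
apply/andP; split; lra.
Qed.

(** Induction on the spanning sequence. If the new vector [v] is at positive
distance from the span of the others, its coefficient is a bounded scalar,
which pigeonholing makes almost constant before the remaining part is treated
by induction. Otherwise [v] lies in the closure of that span, and [h] is
replaced by a nearby map into it. *)
Lemma finite_span_concentration (s : seq Y) T (S : set T) (h : T -> Y) (M e : R) :
  [set: K] #<= S -> (forall x, S x -> lspan [set` s] (h x) /\ `|h x| <= M) ->
  0 < e -> exists2 S' : set T, S' `<=` S /\ [set: K] #<= S' &
    forall x y, S' x -> S' y -> `|h x - h y| <= e.
Proof.
elim: s T S h M e => [|v s IH] T S h M e KS hP e0.
  exists S; first by split.
  move=> x y /hP[/lspan_nil-> _] /hP[/lspan_nil-> _].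
  by rewrite subrr normr0 ltW.
have [s0 sD] := (is_subspaceP _).1 (lspan_is_subspace [set` s]).
have [[dl dl0 dlP]|near] := pselect (exists2 dl : R, 0 < dl &
    forall f, lspan [set` s] f -> dl <= `|v + f|).
  have /choice[af afP] : forall x, exists af : R * Y, S x ->
      lspan [set` s] af.2 /\ h x = af.1 *: v + af.2.
    move=> x; have [Sx|] := pselect (S x); last by exists (0, 0).
    by have [/lspan_cons[a [f [sf hE]]] _] := hP x Sx; exists (a, f).
  have aB x : S x -> `|(af x).1| <= M / dl.
    move=> Sx; have [sf hE] := afP _ Sx; have [_] := hP _ Sx; rewrite hE.
    have [->|aN0] := eqVneq (af x).1 0.
      by move=> /(le_trans (normr_ge0 _)) M0; rewrite normr0 divr_ge0// ltW.
    rewrite ler_pdivlMr//; apply: le_trans.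
    have -> : (af x).1 *: v + (af x).2 =
        (af x).1 *: (v + (af x).1^-1 *: (af x).2).
      by rewrite scalerDr scalerA mulfV// scale1r.
    rewrite normrZ; apply: ler_wpM2l => //; apply: dlP.
    by rewrite -[_ *: _]addr0; exact: sD.
  pose t := e / 2 / (`|v| + 1).
  have t0 : 0 < t by rewrite !divr_gt0// ltr_wpDl.
  have [S1 [S1S KS1] S1P] := bounded_scalar_pigeonhole KS aB t0.
  have [||S2 [S2S1 KS2] S2P] := IH T S1 (fun x => (af x).2)
    (M + M / dl * `|v|) (e / 2) KS1; last 2 first.
  - by rewrite divr_gt0.
  - exists S2; first by split=> // x /S2S1/S1S.
    move=> x y S2x S2y; have S1x := S2S1 _ S2x; have S1y := S2S1 _ S2y.
    have [_ ->] := afP _ (S1S _ S1x); have [_ ->] := afP _ (S1S _ S1y).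
    rewrite opprD addrACA -scalerBl (le_trans (ler_normD _ _))// normrZ.
    rewrite (splitr e) lerD//; last exact: S2P.
    have := S1P _ _ S1x S1y; rewrite /t ler_pdivlMr ?ltr_wpDl//; apply: le_trans.
    by rewrite mulrDr lerDl mulr1.
  - move=> x S1x; have Sx := S1S _ S1x; have [sf hE] := afP _ Sx; split=> //.
    have [_ hM] := hP _ Sx.
    have -> : (af x).2 = h x - (af x).1 *: v by rewrite hE addrAC subrr add0r.
    rewrite (le_trans (ler_normB _ _))// lerD// normrZ.
    by apply: ler_wpM2r => //; exact: aB.
have /choice[h' h'P] : forall x, exists f, S x ->
    lspan [set` s] f /\ `|h x - f| <= e / 3.
  move=> x; have [Sx|] := pselect (S x); last by exists 0.
  have [/lspan_cons[a [f [sf ->]]] _] := hP x Sx.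
  have [g sg vg] : exists2 g, lspan [set` s] g & `|v + g| < e / 3 / (`|a| + 1).
    apply: contrapT => ng; apply: near; exists (e / 3 / (`|a| + 1)).
      by rewrite !divr_gt0// ltr_wpDl.
    by move=> g sg; rewrite leNgt; apply/negP => vg; apply: ng; exists g.
  exists ((- a) *: g + f) => _; split; first exact: sD.
  have -> : a *: v + f - ((- a) *: g + f) = a *: (v + g).
    by rewrite opprD addrACA subrr addr0 scaleNr opprK scalerDr.
  have := ltW vg; rewrite ler_pdivlMr ?ltr_wpDl// normrZ mulrC; apply: le_trans.
  by rewrite mulrDl lerDl mul1r.
have [||S' S'S S'P] := IH T S h' (M + e / 3) (e / 3) KS; last 2 first.
- by rewrite divr_gt0.
- exists S' => // x y S'x S'y.
  have [_ hx] := h'P _ (S'S.1 _ S'x); have [_ hy] := h'P _ (S'S.1 _ S'y).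
  exact: (ler_dist_approx hx hy (S'P _ _ S'x S'y)).
- move=> x Sx; have [h's hh'] := h'P _ Sx; split=> //.
  have [_ hM] := hP _ Sx.
  have -> : h' x = h x - (h x - h' x) by rewrite subKr.
  by rewrite (le_trans (ler_normB _ _))// lerD.
Qed.

Lemma seq_pigeonhole T (S : set T) (D : set Y) (s : T -> seq Y) n :
  card_lt D (cf K) -> [set: K] #<= S ->
  (forall x, S x -> size (s x) = n /\ forall y, y \in s x -> D y) ->
  exists2 S' : set T, S' `<=` S /\ [set: K] #<= S' &
    exists t : seq Y, forall x, S' x -> s x = t.
Proof.
move=> Dcf; elim: n S s => [|n IH] S s KS sP.
  by exists S; [split | exists [::] => x /sP[/size0nil]].
have hD x : S x -> D (head 0 (s x)).
  by move=> /sP[]; case: (s x) => //= y u _; apply; rewrite inE eqxx.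
have [y Ky] := cf_pigeonhole Kcard KS hD Dcf.
have [x [Sx _]|S' [S'S KS'] [t tP]] := IH _ (fun x => behead (s x)) Ky.
  have [sz sD] := sP x Sx; rewrite size_behead sz; split=> // z zs.
  exact/sD/mem_behead.
exists S'; first by split=> // x /S'S[].
exists (y :: t) => x S'x; have [Sx <-] := S'S _ S'x; have := tP _ S'x.
by have [] := sP _ Sx; case: (s x) => //= ? ? _ _ ->.
Qed.

(** When [D] is infinite there are fewer than [cf K] possible lengths of a finite
support, and fewer than [cf K] choices for each of its entries; a finite [D]
is a common support by itself. *)
Lemma finite_support_pigeonhole T (S : set T) (D : set Y) (h : T -> Y) :
  card_lt D (cf K) -> [set: K] #<= S -> (forall x, S x -> lspan D (h x)) ->
  exists2 S' : set T, S' `<=` S /\ [set: K] #<= S' &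
    exists t : seq Y, forall x, S' x -> lspan [set` t] (h x).
Proof.
move=> Dcf KS hD.
have [/finite_seqP[t Dt]|Dinf] := pselect (finite_set D).
  by exists S; [split | exists t => x /hD; rewrite Dt].
have /choice[s sP] : forall x, exists s : seq Y, S x ->
    (forall y, y \in s -> D y) /\ lspan [set` s] (h x).
  move=> x; have [/hD/lspan_finite_support[s sP]|] := pselect (S x).
    by exists s.
  by exists [::].
have natcf : card_lt [set: nat] (cf K).
  case: Dcf => [Dcf cfD]; move/infiniteP: Dinf => natD.
  split; first exact: card_le_trans natD Dcf.
  by move=> /card_le_trans/(_ natD).
have [n Kn] := cf_pigeonhole (h := size \o s) Kcard KS (fun _ _ => I) natcf.
have [x [Sx <-]|S' [S'S KS'] [t tP]] := seq_pigeonhole (s := s) (n := n) Dcf Kn.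
  by split=> //; have [] := sP _ Sx.
exists S'; first by split=> // x /S'S[].
by exists t => x S'x; rewrite -(tP _ S'x); have [Sx _] := S'S _ S'x; have [] := sP _ Sx.
Qed.

(** Approximate [h] within [e / 3] by a map into the span of a minimal spanning
set of a dense subspace, then pass to a common finite-dimensional subspace.
*)
Lemma dens_concentration T (S : set T) (h : T -> Y) (M e : R) :
  card_lt (dens [set: Y]) (cf K) -> [set: K] #<= S ->
  (forall x, S x -> `|h x| <= M) -> 0 < e ->
  exists2 S' : set T, S' `<=` S /\ [set: K] #<= S' &
    forall x y, S' x -> S' y -> `|h x - h y| <= e.
Proof.
move=> Dcf KS hM e0; have e3 : 0 < e / 3 by rewrite divr_gt0.
have [[_ Ddense] _] := min_cardP (dens_set_nonempty [set: Y]).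
have /choice[h' h'P] : forall x, exists f,
    lspan (dens [set: Y]) f /\ `|h x - f| <= e / 3.
  move=> x; have [f [Df]] := Ddense (h x) I _ (nbhsx_ballx (h x) _ e3).
  by rewrite -ball_normE /= => /ltW hf; exists f.
have [S1 [S1S KS1] [t tP]] := finite_support_pigeonhole (h := h') Dcf KS
  (fun x _ => (h'P x).1).
have [x S1x||S' [S'S1 KS'] S'P] :=
    @finite_span_concentration t _ S1 h' (M + e / 3) (e / 3) KS1 => //.
  split; first exact: tP.
  have -> : h' x = h x - (h x - h' x) by rewrite subKr.
  by rewrite (le_trans (ler_normB _ _))// lerD//; [exact/hM/S1S | exact: (h'P x).2].
exists S'; first by split=> // x /S'S1/S1S.
move=> x y S'x S'y; have [_ hx] := h'P x; have [_ hy] := h'P y.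
exact: (ler_dist_approx hx hy (S'P _ _ S'x S'y)).
Qed.

End Concentration.

(** * Crowded cylinders and the Kottman constant *)

(** Suppose every such cylinder contains fewer than [K] points of [P]. Then the
[X]-components, taken relative to the centre [v], of its points in the
cylinder around [v] span a subspace [Z] of small density. Moving the centre
by [l *: x], with [x] octahedral for [Z], increases the [X]-distance to each
of them by at least a constant [c] and leaves the [Y]-distance
unchanged. The points of [P] within [r] of the new centre are among them,
hence they are within [r] of [v] as well, with an [X]-distance smaller by
[c]. Iterating, every [v] has a point of [P] within [r] whose [X]-distance to
[v] is at most [r - n * c], which is absurd for large [n]. *)
Lemma octahedral_crowded_cylinder (R : realType) (d : Order.disp_t)
    (K : orderType d) (phi : R -> R) (X Y : normedModType R) (p : \bar R)
    (r l : R) (P : set (X * Y)) :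
  infinite_cardinal K -> positive_modulus phi -> octahedral K phi X ->
  (1%:E <= p)%E -> 0 < r -> rdense (psum_norm p) r P -> 0 < l ->
  exists v : X * Y, [set: K] #<=
    [set w | [/\ P w, `|w.1 - v.1| <= r + l & `|w.2 - v.2| <= r]].
Proof.
move=> Kcard phiP oct p1 r0 Pdense l0; apply: contrapT => /forallNP few.
have [|c c0 gap] := octahedral_gap (T := r + l) phiP oct _ l0; first lra.
have closer n : forall v, exists2 w, P w &
    psum_norm p (v - w) <= r /\ `|(v - w).1| <= r - n%:R * c.
  elim: n => [|n IH] v.
    have [w Pw vw] := Pdense v; exists w => //; split=> //.
    by rewrite mul0r subr0 (le_trans (norm1_le_psum_norm p1 _)).
  set A := [set w | [/\ P w, `|w.1 - v.1| <= r + l & `|w.2 - v.2| <= r]].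
  pose D := (fun w => w.1 - v.1) @` A.
  have [||x [x1 xP]] := gap (lspan D); first exact: lspan_is_subspace.
    apply/(card_lt_cardinalP Kcard) => KD; apply: (few v).
    apply: card_le_trans KD _; apply: card_le_trans (dens_lspan_le D) _.
    exact: card_image_le.
  have [w Pw [Nw w1]] := IH (v.1 + l *: x, v.2); exists w => //.
  have nc : 0 <= n%:R * c by rewrite mulr_ge0// ltW.
  have wE : w.1 - v.1 - l *: x = - ((v.1 + l *: x, v.2) - w).1.
    by rewrite /= opprB opprD addrA.
  have wx : `|w.1 - v.1 - l *: x| <= r - n%:R * c by rewrite wE normrN.
  have wv : `|w.1 - v.1| <= r + l.
    rewrite -[w.1 - v.1](subrK (l *: x)) (le_trans (ler_normD _ _))//.
    by rewrite lerD ?normrZ ?x1 ?mulr1 ?gtr0_norm//; lra.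
  have Aw : A w.
    split=> //; rewrite -normrN opprB; apply: le_trans Nw.
    exact: (norm2_le_psum_norm p1 ((v.1 + l *: x, v.2) - w)).
  have {}xP : `|w.1 - v.1| + c <= `|w.1 - v.1 - l *: x|.
    by apply: xP => //; apply: sub_lspan; exists w.
  have vw : `|(v - w).1| = `|w.1 - v.1| by rewrite -normrN /= opprB.
  split; last by rewrite vw -natr1 mulrDl mul1r; lra.
  apply: le_trans Nw; apply: (le_psum_norm p1) => //.
  rewrite vw; move: xP; rewrite wE normrN; apply: le_trans.
  by rewrite lerDl ltW.
(* For this n the bound r - n * c is negative. *)
have [w _ [_]] := closer (Num.truncn (r / c)).+1 0.
have := truncnS_gt (r / c); rewrite ltr_pdivrMr// => rc.
move=> /(le_trans (normr_ge0 _)); lra.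
Qed.

Section Kottman.
Context {R : realType} {d : Order.disp_t} {K : orderType d} {X : normedModType R}.
Hypothesis Kcard : infinite_cardinal K.

Lemma kottman_radius_le2 (r : R) (Q : set X) :
  Q `<=` [set x | `|x| <= 1] -> rseparated Num.norm r Q -> [set: K] #<= Q ->
  r <= 2.
Proof.
move=> Qball Qsep KQ.
have Qinf : infinite_set Q.
  by case: Kcard => _ _ Kinf /(card_le_finite KQ).
have [x Qx] := infinite_setN0 Qinf.
have [y Qy xy] : exists2 y, Q y & x <> y.
  apply: contrapT => ny; apply: Qinf; apply: (sub_finite_set _ (finite_set1 x)).
  by move=> y Qy /=; apply: contrapT => yx; apply: ny; exists y => // /esym.
apply: le_trans (Qsep _ _ Qx Qy xy) _; apply: le_trans (ler_normB _ _) _.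
by have := Qball _ Qx; have := Qball _ Qy; rewrite /=; lra.
Qed.

(** The supremum of an unbounded set is 0 by convention, hence the appeal to the
bound 2. *)
Lemma kottman_ge (r : R) (Q : set X) : 0 < r ->
  Q `<=` [set x | `|x| <= 1] -> rseparated Num.norm r Q -> [set: K] #<= Q ->
  r <= kottman X K.
Proof.
move=> r0 Qball Qsep KQ; apply: ub_le_sup.
  exists 2 => s [_ [P [Pball Psep PK]]]; apply: kottman_radius_le2 Pball Psep _.
  by move: PK => /card_eqPle[].
split=> //; have [f [fQ finj]] := card_le_set_inj 0 KQ.
exists (range f); split.
- by move=> _ [k _ <-]; exact/Qball/fQ.
- by move=> _ _ [k _ <-] [k' _ <-]; apply: Qsep; exact: fQ.
- by apply: inj_card_eq => k k' _ _; exact: finj.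
Qed.

Lemma kottman_le2 : kottman X K <= 2.
Proof.
have [s0|/set0P sN0] := eqVneq [set r : R | 0 < r /\ exists P : set X,
    [/\ P `<=` [set x | `|x| <= 1], rseparated Num.norm r P & P #= [set: K]]] set0.
  by rewrite /kottman s0 sup0.
apply: ge_sup => // s [_ [P [Pball Psep PK]]].
apply: kottman_radius_le2 Pball Psep _.
by move: PK => /card_eqPle[].
Qed.
End Kottman.

Theorem theorem5p10 (R : realType) (d : Order.disp_t) (K : orderType d)
    (phi : R -> R) (X : normedModType R) :
  infinite_cardinal K -> positive_modulus phi -> octahedral K phi X ->
  forall (Y : normedModType R) (p : \bar R),
    card_lt (dens [set: Y]) (cf K) -> (1%:E <= p)%E ->
    2 / kottman X K <= gamma (@psum_norm R X Y p).
Proof.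
move=> Kcard phiP oct Y p Ydens p1; apply: (gamma_ge p1) => r P r0 Pdense Psep.
have bound e : 0 < e -> e < 1 -> (2 - e) / (r + e) <= kottman X K.
  move=> e0 e1; have re0 : 0 < r + e by rewrite addr_gt0.
  have [v KA] := octahedral_crowded_cylinder Kcard phiP oct p1 r0 Pdense e0.
  have [w []//|A [AP KA'] Aclose] :=
    dens_concentration (h := fun w : X * Y => w.2 - v.2) (M := r) Kcard Ydens KA _ e0.
  (* Points of A differ by at most e in Y, hence by at least 2 - e in X; the
     rescaled X-components lie in the unit ball. *)
  pose f (w : X * Y) := (r + e)^-1 *: (w.1 - v.1).
  have fsep w w' : A w -> A w' -> w <> w' -> (2 - e) / (r + e) <= `|f w - f w'|.
    move=> Aw Aw' ww'; have [Pw _ _] := AP _ Aw; have [Pw' _ _] := AP _ Aw'.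
    have := le_trans (Psep _ _ Pw Pw' ww') (psum_norm_le_add p1 _) => /= sep.
    have := Aclose _ _ Aw Aw'; rewrite opprB addrA subrK => close.
    rewrite /f -scalerBr opprB addrA subrK normrZ normfV gtr0_norm//.
    by rewrite [leRHS]mulrC ler_pM2r ?invr_gt0//; lra.
  have c0 : 0 < (2 - e) / (r + e) by rewrite divr_gt0//; lra.
  apply: (@kottman_ge _ _ _ _ Kcard _ (f @` A)) => //.
  - move=> _ [w Aw <-] /=; have [_ w1 _] := AP _ Aw.
    by rewrite /f normrZ normfV gtr0_norm// mulrC ler_pdivrMr// mul1r.
  - by move=> _ _ [w Aw <-] [w' Aw' <-] ff; apply: fsep => // ww'; rewrite ww' in ff.
  - apply: card_le_trans KA' _; apply: (@inj_card_le_set _ _ _ _ f).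
      by move=> w Aw; exists w.
    move=> w w' Aw Aw' ff; apply: contrapT => /(fsep _ _ Aw Aw').
    by rewrite ff subrr normr0 leNgt c0.
(* Let e tend to 0: bound gives 2 - r * kottman <= (1 + kottman) * e <= 3 * e. *)
have k2 := @kottman_le2 R d K X Kcard.
have k0 : 0 < kottman X K.
  by apply: lt_le_trans (bound (1 / 2) _ _); rewrite ?divr_gt0//; lra.
rewrite ler_pdivrMr// leNgt; apply/negP => rk.
pose e := Num.min (1 / 2) ((2 - r * kottman X K) / 6).
have e0 : 0 < e by rewrite lt_min !divr_gt0// subr_gt0.
have e2 : e <= 1 / 2 by rewrite ge_min lexx.
have e6 : e <= (2 - r * kottman X K) / 6 by rewrite ge_min lexx orbT.
have := bound e e0; rewrite ler_pdivrMr ?addr_gt0// mulrDr [_ * r]mulrC.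
have : kottman X K * e <= 2 * e by rewrite ler_pM2r.
move: rk e6; set k := kottman X K in k2 k0 *; set rk := r * k => h1 h2 h3 h4.
have : e < 1 by lra.
move=> /h4; lra.
Qed.
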